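(* The Cesàro operator $\mathsf{C}\colon C([0,1])\to C([0,1])$ is power bounded and mean ergodic, but not uniformly mean ergodic. Also, $\mathsf{C}$ fails to be hypercyclic.
   Context: $C([0,1])$ is the Banach space of all $\mathbb{C}$-valued continuous functions on $[0,1]$ with the sup-norm. The continuous Cesàro operator is $\mathsf{C}f(x):=\frac1x\int_0^x f(t)\,dt$ for $x\in(0,1]$, with $\mathsf{C}f(0):=f(0)$. For a bounded linear operator $T$ on a Banach space $X$ set $T_{[n]}:=\frac1n\sum_{m=1}^n T^m$, $n\in\mathbb{N}$. $T$ is power bounded if $\sup_{n\in\mathbb{N}}\|T^n\|_{op}<\infty$; mean ergodic if $(T_{[n]})_{n}$ converges in the strong operator topology to a bounded linear operator on $X$; uniformly mean ergodic if $(T_{[n]})_n$ converges in operator norm. For $X$ separable, $T$ is hypercyclic if there is $x\in X$ whose orbit $\{T^nx\colon n\in\mathbb{N}_0\}$ is dense in $X$. *)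

(* Defs.v *)
From Stdlib Require Import Reals Arith Lra Lia.
From Stdlib Require Import ProofIrrelevance FunctionalExtensionality
  PropExtensionality Classical ClassicalEpsilon.
From Coquelicot Require Import Coquelicot.
Open Scope R_scope.

(** * Bounded operators on a complex Banach space

    Coquelicot's [is_linear] is linearity together with boundedness. *)

Record bounded_operator (X : CompleteNormedModule C_AbsRing) := BoundedOperator {
  op_fun :> X -> X;
  op_is_linear : is_linear op_fun }.

Arguments BoundedOperator {X} op_fun op_is_linear.
Arguments op_fun {X} b x.
Arguments op_is_linear {X} b.

Section Operators.
Context {X : CompleteNormedModule C_AbsRing}.
Implicit Types S T P : bounded_operator X.

(** The supremum is finite because [T] is bounded, so that [real] only casts
    it from [Rbar] to [R]. *)
Definition op_norm T : R :=
  real (Lub_Rbar (fun r => exists x : X, norm x <= 1 /\ r = norm (T x))).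

Lemma is_linear_iter T n : is_linear (fun x : X => Nat.iter n T x).
Proof.
  induction n as [|n IH]; simpl.
  - apply is_linear_id.
  - apply (is_linear_comp _ _ IH (op_is_linear T)).
Qed.

Definition op_pow T (n : nat) : bounded_operator X :=
  BoundedOperator (fun x => Nat.iter n T x) (is_linear_iter T n).

Lemma is_linear_sum_n_m (u : nat -> bounded_operator X) (a b : nat) :
  is_linear (fun x : X => sum_n_m (fun m => u m x) a b).
Proof.
  induction b as [|b IH].
  - destruct a as [|a].
    + apply (is_linear_ext (u 0%nat)).
      * intros x; now rewrite sum_n_n.
      * apply op_is_linear.
    + apply (is_linear_ext (fun _ => zero)).
      * intros x; rewrite sum_n_m_zero; [easy | lia].
      * apply is_linear_zero.
  - destruct (le_lt_dec a (S b)) as [H|H].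
    + apply (is_linear_ext
        (fun x : X => plus (sum_n_m (fun m => u m x) a b) (u (S b) x))).
      * intros x; now rewrite sum_n_Sm.
      * apply (is_linear_comp (V := prod_NormedModule C_AbsRing X X)
          (fun x : X => (sum_n_m (fun m => u m x) a b, u (S b) x))
          (fun t : X * X => plus (fst t) (snd t))).
        -- apply is_linear_prod; [exact IH | apply op_is_linear].
        -- apply (@is_linear_plus C_AbsRing X).
    + apply (is_linear_ext (fun _ => zero)).
      * intros x; rewrite sum_n_m_zero; [easy | lia].
      * apply is_linear_zero.
Qed.

Lemma is_linear_mean T n :
  is_linear (fun x : X => scal (RtoC (1 / INR n))
                            (sum_n_m (fun m => op_pow T m x) 1 n)).
Proof.
  apply (is_linear_comp (fun x : X => sum_n_m (fun m => op_pow T m x) 1 n)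
           (fun x : X => scal (RtoC (1 / INR n)) x)).
  - apply is_linear_sum_n_m.
  - apply (@is_linear_scal_r C_AbsRing X). exact Cmult_comm.
Qed.

(** Only meaningful for [n >= 1]. *)
Definition op_mean T (n : nat) : bounded_operator X :=
  BoundedOperator (fun x => scal (RtoC (1 / INR n))
                              (sum_n_m (fun m => op_pow T m x) 1 n))
    (is_linear_mean T n).

Lemma is_linear_minus S T : is_linear (fun x : X => minus (S x) (T x)).
Proof.
  apply (is_linear_comp (V := prod_NormedModule C_AbsRing X X)
           (fun x : X => (S x, opp (T x)))
           (fun t : X * X => plus (fst t) (snd t))).
  - apply is_linear_prod; [apply op_is_linear |].
    apply (is_linear_comp T opp (op_is_linear T)), is_linear_opp.
  - apply (@is_linear_plus C_AbsRing X).
Qed.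

Definition op_minus S T : bounded_operator X :=
  BoundedOperator (fun x => minus (S x) (T x)) (is_linear_minus S T).

Definition power_bounded T : Prop :=
  Rbar_lt (Sup_seq (fun n => Finite (op_norm (op_pow T (Datatypes.S n)))))
    p_infty.

Definition mean_ergodic T : Prop :=
  exists P, forall x : X,
    filterlim (fun n => op_mean T n x) eventually (locally (P x)).

Definition uniformly_mean_ergodic T : Prop :=
  exists P, is_lim_seq (fun n => op_norm (op_minus (op_mean T n) P)) 0.

(** Separability of [X] is not part of the predicate: a dense orbit implies
    it. *)
Definition hypercyclic T : Prop :=
  exists x : X, forall (y : X) (eps : posreal),
    exists n : nat, ball y eps (op_pow T n x).

End Operators.

(** * The unit interval *)

Record unit_interval := UnitInterval {
  ui_val :> R;
  ui_bounds : 0 <= ui_val <= 1 }.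

Lemma ui_eq (x y : unit_interval) : ui_val x = ui_val y -> x = y.
Proof.
  destruct x as [x Hx], y as [y Hy]; simpl; intros <-.
  f_equal; apply proof_irrelevance.
Qed.

Lemma ui0_bounds : 0 <= 0 <= 1. Proof. lra. Qed.
Definition ui0 : unit_interval := UnitInterval 0 ui0_bounds.

Definition ui_ball (x : unit_interval) (e : R) (y : unit_interval) : Prop :=
  ball (ui_val x) e (ui_val y).

Lemma ui_ball_center x (e : posreal) : ui_ball x e x.
Proof. apply ball_center. Qed.
Lemma ui_ball_sym x y e : ui_ball x e y -> ui_ball y e x.
Proof. apply ball_sym. Qed.
Lemma ui_ball_triangle x y z e1 e2 :
  ui_ball x e1 y -> ui_ball y e2 z -> ui_ball x (e1 + e2) z.
Proof. apply ball_triangle. Qed.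

Definition ui_UniformSpace_mixin :=
  UniformSpace.Mixin unit_interval ui0 ui_ball
    ui_ball_center ui_ball_sym ui_ball_triangle.
Canonical ui_UniformSpace :=
  UniformSpace.Pack unit_interval ui_UniformSpace_mixin unit_interval.

(** The retraction of [R] onto [[0,1]]; it lets a function on [[0,1]] be
    integrated by [RInt], which wants an integrand defined on all of [R]. *)
Lemma clamp_bounds (t : R) : 0 <= Rmax 0 (Rmin 1 t) <= 1.
Proof.
  split; [apply Rmax_l |].
  apply Rmax_lub; [lra | apply Rmin_l].
Qed.
Definition clamp (t : R) : unit_interval := UnitInterval _ (clamp_bounds t).

Lemma clamp_val (t : R) : 0 <= t <= 1 -> ui_val (clamp t) = t.
Proof.
  intros H; simpl; rewrite Rmin_right, Rmax_right; lra.
Qed.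

Lemma clampK (x : unit_interval) : clamp x = x.
Proof. apply ui_eq, clamp_val, ui_bounds. Qed.

Lemma clamp_lipschitz (s t : R) :
  Rabs (ui_val (clamp s) - ui_val (clamp t)) <= Rabs (s - t).
Proof.
  simpl; unfold Rmax, Rmin.
  repeat destruct Rle_dec; unfold Rabs; repeat destruct Rcase_abs; lra.
Qed.

Lemma clamp_continuous (t : R) : continuous clamp t.
Proof.
  apply filterlim_locally; intros eps; exists eps; intros s Hs.
  apply Rle_lt_trans with (2 := Hs), clamp_lipschitz.
Qed.

(** * The Banach space C([0,1]) *)

Record C01 := MkC01 {
  c01_fun :> unit_interval -> C;
  c01_continuous : forall x, continuous c01_fun x }.

Lemma c01_eq (f g : C01) : (forall x, f x = g x) -> f = g.
Proof.
  destruct f as [f Hf], g as [g Hg]; simpl; intros H.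
  assert (E : f = g) by (apply functional_extensionality; exact H).
  subst g; f_equal; apply proof_irrelevance.
Qed.

Lemma ui_C_continuous (f : unit_interval -> C) (x : unit_interval) :
  continuous f x <->
  forall eps : posreal, exists d : posreal, forall y : unit_interval,
    Rabs (y - x) < d -> Cmod (f y - f x) < eps.
Proof.
  split.
  - intros H eps.
    assert (K : @locally C_NormedModule (f x) (fun z => Cmod (z - f x) < eps)).
    { apply (@locally_le_locally_norm _ C_NormedModule).
      exists eps; intros z Hz; exact Hz. }
    destruct (H _ K) as [d Hd]; exists d; intros y Hy; now apply Hd.
  - intros H; apply filterlim_locally; intros eps.
    destruct (H eps) as [d Hd]; exists d; intros y Hy.
    apply (@norm_compat1 _ C_NormedModule), Hd, Hy.
Qed.

(** The extension of [f] to [R] that is constant outside [[0,1]]. *)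
Definition extend (f : unit_interval -> C) (t : R) : C := f (clamp t).

Lemma extend_continuous (f : C01) (t : R) : continuous (extend f) t.
Proof.
  apply (continuous_comp clamp f);
    [apply clamp_continuous | apply c01_continuous].
Qed.

Lemma Cmod_continuous (z : C) : continuous Cmod z.
Proof.
  apply (@filterlim_norm _ C_NormedModule).
Qed.

Lemma c01_bounded (f : C01) : exists M, forall x, Cmod (f x) <= M.
Proof.
  destruct (continuity_ab_maj (fun t => Cmod (extend f t)) 0 1) as [m [Hm _]].
  - lra.
  - intros t _; apply continuity_pt_filterlim.
    apply (continuous_comp (extend f) Cmod);
      [apply extend_continuous | apply Cmod_continuous].
  - exists (Cmod (extend f m)); intros x.
    rewrite <- (clampK x); apply (Hm x), ui_bounds.
Qed.

Definition sup_norm (f : C01) : R :=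
  real (Lub_Rbar (fun r => exists x, r = Cmod (f x))).

Lemma sup_norm_is_lub (f : C01) :
  is_lub_Rbar (fun r => exists x, r = Cmod (f x)) (Finite (sup_norm f)).
Proof.
  unfold sup_norm.
  generalize (Lub_Rbar_correct (fun r => exists x, r = Cmod (f x))).
  destruct (c01_bounded f) as [M HM].
  destruct Lub_Rbar as [l| |]; simpl; intros [H1 H2].
  - split; assumption.
  - destruct (H2 (Finite M)).
    intros r [x ->]; apply HM.
  - destruct (H1 (Cmod (f ui0))).
    now exists ui0.
Qed.

Lemma sup_norm_ub (f : C01) x : Cmod (f x) <= sup_norm f.
Proof. apply (proj1 (sup_norm_is_lub f)); now exists x. Qed.

Lemma sup_norm_le (f : C01) M : (forall x, Cmod (f x) <= M) -> sup_norm f <= M.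
Proof.
  intros H; apply (proj2 (sup_norm_is_lub f) (Finite M)).
  intros r [x ->]; apply H.
Qed.

Lemma c01_plus_continuous (f g : C01) x : continuous (fun t => f t + g t)%C x.
Proof.
  apply (continuous_plus (V := C_R_NormedModule) f g); apply c01_continuous.
Qed.
Definition c01_plus (f g : C01) : C01 := MkC01 _ (c01_plus_continuous f g).

Lemma c01_opp_continuous (f : C01) x : continuous (fun t => - f t)%C x.
Proof.
  apply (continuous_opp (V := C_R_NormedModule) f); apply c01_continuous.
Qed.
Definition c01_opp (f : C01) : C01 := MkC01 _ (c01_opp_continuous f).

Lemma c01_scal_continuous (c : C) (f : C01) x : continuous (fun t => c * f t)%C x.
Proof.
  apply (continuous_comp f (fun z => c * z)%C); [apply c01_continuous |].
  apply (@filterlim_scal_r _ C_NormedModule).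
Qed.
Definition c01_scal (c : C) (f : C01) : C01 :=
  MkC01 _ (c01_scal_continuous c f).

Lemma c01_zero_continuous x :
  continuous (fun _ : unit_interval => RtoC 0) x.
Proof. apply continuous_const. Qed.
Definition c01_zero : C01 := MkC01 _ c01_zero_continuous.

Lemma c01_plus_comm f g : c01_plus f g = c01_plus g f.
Proof. apply c01_eq; intros x; apply Cplus_comm. Qed.
Lemma c01_plus_assoc f g h :
  c01_plus f (c01_plus g h) = c01_plus (c01_plus f g) h.
Proof. apply c01_eq; intros x; apply Cplus_assoc. Qed.
Lemma c01_plus_zero f : c01_plus f c01_zero = f.
Proof. apply c01_eq; intros x; apply Cplus_0_r. Qed.
Lemma c01_plus_opp f : c01_plus f (c01_opp f) = c01_zero.
Proof. apply c01_eq; intros x; apply Cplus_opp_r. Qed.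

Definition c01_AbelianMonoid_mixin :=
  AbelianMonoid.Mixin C01 c01_plus c01_zero
    c01_plus_comm c01_plus_assoc c01_plus_zero.
Canonical c01_AbelianMonoid :=
  AbelianMonoid.Pack C01 c01_AbelianMonoid_mixin C01.
Definition c01_AbelianGroup_mixin :=
  AbelianGroup.Mixin c01_AbelianMonoid c01_opp c01_plus_opp.
Canonical c01_AbelianGroup :=
  AbelianGroup.Pack C01
    (AbelianGroup.Class C01 c01_AbelianMonoid_mixin c01_AbelianGroup_mixin) C01.

Lemma c01_scal_assoc (c d : C) f :
  c01_scal c (c01_scal d f) = c01_scal (c * d)%C f.
Proof. apply c01_eq; intros x; apply Cmult_assoc. Qed.
Lemma c01_scal_one f : c01_scal (RtoC 1) f = f.
Proof. apply c01_eq; intros x; apply Cmult_1_l. Qed.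
Lemma c01_scal_plus_r (c : C) f g :
  c01_scal c (c01_plus f g) = c01_plus (c01_scal c f) (c01_scal c g).
Proof. apply c01_eq; intros x; apply Cmult_plus_distr_l. Qed.
Lemma c01_scal_plus_l (c d : C) f :
  c01_scal (c + d)%C f = c01_plus (c01_scal c f) (c01_scal d f).
Proof. apply c01_eq; intros x; apply Cmult_plus_distr_r. Qed.

Definition c01_ModuleSpace_mixin :=
  ModuleSpace.Mixin C_AbsRing c01_AbelianGroup c01_scal
    c01_scal_assoc c01_scal_one c01_scal_plus_r c01_scal_plus_l.
Canonical c01_ModuleSpace :=
  ModuleSpace.Pack C_AbsRing C01
    (ModuleSpace.Class C_AbsRing C01 (AbelianGroup.class c01_AbelianGroup)
       c01_ModuleSpace_mixin) C01.

Lemma sup_norm_triangle (f g : C01) :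
  sup_norm (plus f g) <= sup_norm f + sup_norm g.
Proof.
  apply sup_norm_le; intros x.
  apply Rle_trans with (1 := Cmod_triangle (f x) (g x)).
  apply Rplus_le_compat; apply sup_norm_ub.
Qed.
Lemma sup_norm_scal (c : C) (f : C01) :
  sup_norm (c01_scal c f) <= Cmod c * sup_norm f.
Proof.
  apply sup_norm_le; intros x; simpl; rewrite Cmod_mult.
  apply Rmult_le_compat_l; [apply Cmod_ge_0 | apply sup_norm_ub].
Qed.
Lemma sup_norm_opp (f : C01) : sup_norm (opp f) = sup_norm f.
Proof.
  apply Rle_antisym; apply sup_norm_le; intros x.
  - simpl; rewrite Cmod_opp; apply sup_norm_ub.
  - rewrite <- Cmod_opp; apply (sup_norm_ub (c01_opp f)).
Qed.
Lemma sup_norm_eq_0 (f : C01) : sup_norm f = 0 -> f = zero.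
Proof.
  intros H; apply c01_eq; intros x; apply Cmod_eq_0, Rle_antisym.
  - rewrite <- H; apply sup_norm_ub.
  - apply Cmod_ge_0.
Qed.

Definition c01_ball (f : C01) (e : R) (g : C01) : Prop :=
  sup_norm (minus g f) < e.

Lemma c01_ball_center f (e : posreal) : c01_ball f e f.
Proof.
  apply Rle_lt_trans with 0; [| apply cond_pos].
  apply sup_norm_le; intros x; simpl.
  rewrite Cplus_opp_r, Cmod_0; lra.
Qed.
Lemma c01_ball_sym f g e : c01_ball f e g -> c01_ball g e f.
Proof.
  unfold c01_ball; intros H.
  now rewrite <- sup_norm_opp, opp_minus.
Qed.
Lemma c01_ball_triangle f g h e1 e2 :
  c01_ball f e1 g -> c01_ball g e2 h -> c01_ball f (e1 + e2) h.
Proof.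
  unfold c01_ball; intros H1 H2.
  rewrite (minus_trans g).
  apply Rle_lt_trans with (1 := sup_norm_triangle _ _); lra.
Qed.

Definition c01_UniformSpace_mixin :=
  UniformSpace.Mixin C01 c01_zero c01_ball
    c01_ball_center c01_ball_sym c01_ball_triangle.
Canonical c01_UniformSpace :=
  UniformSpace.Pack C01 c01_UniformSpace_mixin C01.

Canonical c01_NormedModuleAux :=
  NormedModuleAux.Pack C_AbsRing C01
    (NormedModuleAux.Class C_AbsRing C01
       (ModuleSpace.class _ c01_ModuleSpace) c01_UniformSpace_mixin) C01.

Lemma c01_norm_compat2 (f g : C01) (eps : posreal) :
  c01_ball f eps g -> sup_norm (minus g f) < 1 * eps.
Proof. now rewrite Rmult_1_l. Qed.

Definition c01_NormedModule_mixin :=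
  NormedModule.Mixin C_AbsRing c01_NormedModuleAux sup_norm 1
    sup_norm_triangle sup_norm_scal (fun _ _ _ H => H) c01_norm_compat2
    sup_norm_eq_0.
Canonical c01_NormedModule :=
  NormedModule.Pack C_AbsRing C01
    (NormedModule.Class C_AbsRing C01
       (NormedModuleAux.class _ c01_NormedModuleAux)
       c01_NormedModule_mixin) C01.

Lemma c01_complete_ex (F : (C01 -> Prop) -> Prop) :
  exists f : C01, ProperFilter F -> cauchy F ->
    forall eps : posreal, F (ball f eps).
Proof.
  destruct (classic (ProperFilter F /\ cauchy F)) as [[FF HF]|H];
    [| exists c01_zero; intros; now destruct H].
  set (G := fun P : (unit_interval -> C_CompleteNormedModule) -> Prop =>
              F (fun f : C01 => P f)).
  assert (FG : ProperFilter G) by exact (filtermap_proper_filter _ _ c01_fun F FF).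
  assert (HG : cauchy G).
  { intros eps; destruct (HF eps) as [f Hf]; exists (c01_fun f).
    unfold G; revert Hf; apply filter_imp; intros g Hg t.
    apply (@norm_compat1 _ C_NormedModule).
    apply Rle_lt_trans with (2 := Hg), (sup_norm_ub (minus g f)). }
  set (h := lim G : unit_interval -> C).
  assert (Hh : forall eps : posreal,
             F (fun f : C01 => forall t, Cmod (f t - h t) < eps)).
  { intros eps.
    assert (Hs : 0 < eps / sqrt 2).
    { apply Rdiv_lt_0_compat; [apply cond_pos | apply Rlt_sqrt2_0]. }
    generalize (complete_cauchy G FG HG (mkposreal _ Hs)); unfold G.
    apply filter_imp; intros f Hf t.
    generalize (@norm_compat2 _ C_NormedModule (h t) (f t) (mkposreal _ Hs) (Hf t)).
    change (@norm_factor C_AbsRing C_NormedModule) with (sqrt 2); simpl.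
    replace (sqrt 2 * (eps / sqrt 2)) with (pos eps); [easy |].
    field; apply Rgt_not_eq, Rlt_sqrt2_0. }
  assert (Hc : forall x, continuous h x).
  { intros x; apply ui_C_continuous; intros eps.
    assert (He : 0 < eps / 3) by (generalize (cond_pos eps); lra).
    destruct (filter_ex _ (Hh (mkposreal _ He))) as [f Hf]; simpl in Hf.
    destruct (proj1 (ui_C_continuous f x) (c01_continuous f x)
                (mkposreal _ He)) as [d Hd]; simpl in Hd.
    exists d; intros y Hy.
    replace (h y - h x)%C
      with (- (f y - h y) + ((f y - f x) + (f x - h x)))%C by ring.
    apply Rle_lt_trans with (1 := Cmod_triangle _ _); rewrite Cmod_opp.
    generalize (Cmod_triangle (f y - f x) (f x - h x)) (Hf x) (Hf y) (Hd y Hy).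
    lra. }
  exists (MkC01 h Hc); intros _ _ eps.
  assert (He : 0 < eps / 2) by (generalize (cond_pos eps); lra).
  generalize (Hh (mkposreal _ He)); apply filter_imp; simpl; intros f Hf.
  apply Rle_lt_trans with (eps / 2); [| lra].
  apply sup_norm_le; intros x; left; apply Hf.
Qed.

Definition c01_lim (F : (C01 -> Prop) -> Prop) : C01 :=
  proj1_sig (constructive_indefinite_description _ (c01_complete_ex F)).

Lemma c01_lim_cauchy (F : (C01 -> Prop) -> Prop) :
  ProperFilter F -> cauchy F -> forall eps : posreal, F (ball (c01_lim F) eps).
Proof.
  exact (proj2_sig (constructive_indefinite_description _ (c01_complete_ex F))).
Qed.

Lemma c01_lim_close (F1 F2 : (C01 -> Prop) -> Prop) :
  filter_le F1 F2 -> filter_le F2 F1 -> close (c01_lim F1) (c01_lim F2).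
Proof.
  intros H1 H2.
  replace F2 with F1; [apply close_refl |].
  apply functional_extensionality; intros P.
  apply propositional_extensionality; split; [apply H2 | apply H1].
Qed.

Canonical c01_CompleteNormedModule :=
  CompleteNormedModule.Pack C_AbsRing C01
    (CompleteNormedModule.Class C_AbsRing C01
       (NormedModule.class _ c01_NormedModule)
       (CompleteSpace.Mixin c01_UniformSpace c01_lim
          c01_lim_cauchy c01_lim_close)) C01.

(** * The Cesàro operator *)

(** [RInt] is taken in [C] as a real Banach space; for [x] in [[0,1]] the
    integrand [extend f] agrees with [f] on [[0,x]]. *)
Definition cesaro_fun (f : unit_interval -> C) (x : unit_interval) : C :=
  if Req_EM_T x 0 then f ui0
  else (RtoC (1 / x) * RInt (V := C_R_CompleteNormedModule) (extend f) 0 x)%C.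

Lemma ex_RInt_extend (f : C01) (a b : R) :
  ex_RInt (V := C_R_NormedModule) (extend f) a b.
Proof.
  apply (ex_RInt_continuous (V := C_R_CompleteNormedModule)).
  intros z _; apply extend_continuous.
Qed.

Lemma is_RInt_extend (f : C01) (a b : R) :
  is_RInt (V := C_R_NormedModule) (extend f) a b
    (RInt (V := C_R_CompleteNormedModule) (extend f) a b).
Proof.
  apply (RInt_correct (V := C_R_CompleteNormedModule)), ex_RInt_extend.
Qed.

Lemma C_R_scal (r : R) (c : C) :
  scal (V := C_R_NormedModule) r c = (RtoC r * c)%C.
Proof.
  apply injective_projections; simpl;
    unfold scal; simpl; unfold mult; simpl; ring.
Qed.

Lemma cesaro_dist (f : C01) (x : unit_interval) (c : C) (M : R) :
  0 < x -> (forall t : unit_interval, t <= x -> Cmod (f t - c) <= M) ->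
  Cmod (RtoC (1 / x) * RInt (V := C_R_CompleteNormedModule) (extend f) 0 x - c)
    <= M.
Proof.
  intros Hx HM.
  set (I := RInt _ _ _).
  assert (HI : is_RInt (V := C_R_NormedModule) (fun t => extend f t - c)%C 0 x
                 (I - scal (V := C_R_NormedModule) (x - 0)%R c)%C).
  { apply (is_RInt_minus (V := C_R_NormedModule));
      [apply is_RInt_extend | apply (is_RInt_const (V := C_R_NormedModule))]. }
  assert (Hb : forall t, 0 <= t <= x ->
                 @norm R_AbsRing C_R_NormedModule (extend f t - c)%C <= M).
  { intros t Ht; rewrite <- Cmod_norm; unfold extend; apply HM.
    rewrite clamp_val; [lra | generalize (ui_bounds x); lra]. }
  assert (Hn := norm_RInt_le_const (V := C_R_NormedModule) _ 0 x _ M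
                  (Rlt_le _ _ Hx) Hb HI).
  rewrite <- Cmod_norm in Hn.
  replace (RtoC (1 / x) * I - c)%C
    with (RtoC (1 / x) * (I - scal (V := C_R_NormedModule) (x - 0)%R c))%C.
  - rewrite Cmod_mult, Cmod_R, Rabs_pos_eq.
    + apply Rmult_le_reg_l with x; [easy |].
      replace (x * (1 / x * Cmod (I - scal (V := C_R_NormedModule) (x - 0)%R c)))
        with (Cmod (I - scal (V := C_R_NormedModule) (x - 0)%R c)) by (field; lra).
      rewrite Rminus_0_r in Hn |- *; exact Hn.
    + apply Rlt_le, Rdiv_lt_0_compat; lra.
  - replace (scal (V := C_R_NormedModule) (x - 0)%R c) with (RtoC x * c)%C.
    + generalize I; intros J; change C in J.
      assert (E : (RtoC (1 / x) * RtoC x = 1)%C).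
      { rewrite <- RtoC_mult; f_equal; field; lra. }
      transitivity (RtoC (1 / x) * J - (RtoC (1 / x) * RtoC x) * c)%C;
        [| rewrite E]; unfold Cminus; ring.
    + now rewrite Rminus_0_r, C_R_scal.
Qed.

Lemma cesaro_fun_continuous (f : C01) x : continuous (cesaro_fun f) x.
Proof.
  destruct (Req_EM_T x 0) as [Hx|Hx].
  - apply ui_C_continuous; intros eps.
    assert (He : 0 < eps / 2) by (generalize (cond_pos eps); lra).
    destruct (proj1 (ui_C_continuous f x) (c01_continuous f x)
                (mkposreal _ He)) as [d Hd]; simpl in Hd.
    assert (E : x = ui0) by now apply ui_eq.
    exists d; intros y Hy; unfold cesaro_fun.
    destruct (Req_EM_T x 0) as [_|]; [| easy].
    apply Rle_lt_trans with (eps / 2); [| generalize (cond_pos eps); lra].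
    destruct (Req_EM_T y 0) as [Hy0|Hy0].
    + unfold Cminus; rewrite Cplus_opp_r, Cmod_0; lra.
    + apply cesaro_dist.
      * generalize (ui_bounds y); lra.
      * intros t Ht; left; rewrite <- E; apply Hd.
        rewrite Hx, Rminus_0_r in Hy |- *.
        rewrite Rabs_pos_eq in Hy |- *; generalize (ui_bounds t) (ui_bounds y); lra.
  - assert (Hx0 : 0 < x) by (generalize (ui_bounds x); lra).
    apply (continuous_ext_loc _ (fun y : unit_interval =>
      scal (V := C_R_NormedModule) (1 / y)
        (RInt (V := C_R_CompleteNormedModule) (extend f) 0 y))).
    + exists (mkposreal _ Hx0); intros y Hy.
      assert (Hy0 : y <> 0 :> R).
      { intros E; change (Rabs (y - x) < x) in Hy; rewrite E in Hy.
        rewrite Rabs_left in Hy; lra. }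
      unfold cesaro_fun; destruct (Req_EM_T y 0) as [|_]; [easy |].
      apply C_R_scal.
    + apply (continuous_comp ui_val (fun t : R =>
        scal (V := C_R_NormedModule) (1 / t)
          (RInt (V := C_R_CompleteNormedModule) (extend f) 0 t))).
      { apply filterlim_locally; intros eps; exists eps; easy. }
      apply (continuous_scal (V := C_R_NormedModule)).
      * apply (ex_derive_continuous (fun t : R => 1 / t)); auto_derive; easy.
      * apply (ex_derive_continuous (V := C_R_NormedModule)).
        exists (extend f x).
        apply (is_derive_RInt (V := C_R_NormedModule) _ _ 0).
        -- apply filter_forall; intros t; apply is_RInt_extend.
        -- apply extend_continuous.
Qed.

Definition cesaro_map (f : C01) : C01 := MkC01 _ (cesaro_fun_continuous f).

Lemma cesaro_plus (f g : C01) :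
  cesaro_map (plus f g) = plus (cesaro_map f) (cesaro_map g).
Proof.
  apply c01_eq; intros x; simpl; unfold cesaro_fun.
  destruct (Req_EM_T x 0); [easy |].
  rewrite <- Cmult_plus_distr_l; f_equal.
  apply (RInt_plus (V := C_R_CompleteNormedModule)); apply ex_RInt_extend.
Qed.

Lemma is_RInt_Cmult (g : R -> C) (a b : R) (c I : C) :
  is_RInt (V := C_R_NormedModule) g a b I ->
  is_RInt (V := C_R_NormedModule) (fun t => c * g t)%C a b (c * I)%C.
Proof.
  intros H.
  assert (H1 := is_RInt_fct_extend_fst (U := R_NormedModule)
                  (V := R_NormedModule) g a b I H).
  assert (H2 := is_RInt_fct_extend_snd (U := R_NormedModule)
                  (V := R_NormedModule) g a b I H).
  apply (is_RInt_fct_extend_pair (U := R_NormedModule) (V := R_NormedModule)).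
  - apply (is_RInt_minus (V := R_NormedModule)
             (fun t => fst c * fst (g t)) (fun t => snd c * snd (g t)));
      apply (is_RInt_scal (V := R_NormedModule)); assumption.
  - apply (is_RInt_plus (V := R_NormedModule)
             (fun t => fst c * snd (g t)) (fun t => snd c * fst (g t)));
      apply (is_RInt_scal (V := R_NormedModule)); assumption.
Qed.

Lemma cesaro_scal (c : C) (f : C01) :
  cesaro_map (scal c f) = scal c (cesaro_map f).
Proof.
  apply c01_eq; intros x; simpl; unfold cesaro_fun.
  destruct (Req_EM_T x 0); [easy |].
  replace (RInt (V := C_R_CompleteNormedModule) (extend (fun t => c * f t)%C) 0 x)
    with (c * RInt (V := C_R_CompleteNormedModule) (extend f) 0 x)%C.
  - ring.
  - symmetry; apply (is_RInt_unique (V := C_R_CompleteNormedModule)).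
    apply is_RInt_Cmult, is_RInt_extend.
Qed.

Lemma cesaro_norm_le (f : C01) : norm (cesaro_map f) <= norm f.
Proof.
  apply sup_norm_le; intros x; simpl; unfold cesaro_fun.
  destruct (Req_EM_T x 0) as [|Hx]; [apply sup_norm_ub |].
  generalize (cesaro_dist f x 0%C (sup_norm f)).
  unfold Cminus; rewrite Copp_0, Cplus_0_r; intros H; apply H.
  - generalize (ui_bounds x); lra.
  - intros t _; rewrite Cplus_0_r; apply sup_norm_ub.
Qed.

Lemma cesaro_is_linear : is_linear cesaro_map.
Proof.
  split.
  - exact cesaro_plus.
  - exact cesaro_scal.
  - exists 1; split; [lra |]; intros f.
    rewrite Rmult_1_l; apply cesaro_norm_le.
Qed.

Definition cesaro : bounded_operator c01_CompleteNormedModule :=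
  BoundedOperator cesaro_map cesaro_is_linear.

(* Main.v *)
(** On [C([0,1])] the operator is a positive contraction, hence power bounded,
    and its orbits are bounded, hence not dense.  Integrating
    [|f t - f 0| <= a + b t], which for each [a > 0] holds with some [b], gives
    [|C^n f t - f 0| <= a + (b / 2^n) t]; so [C^n f], and with it the means,
    tend uniformly to the constant [f 0].  If the means converged in norm, the
    limit would therefore be [f |-> f 0].  But [x^(2^-k)], an iterated square
    root, has norm one, vanishes at 0 and is an eigenvector with eigenvalue
    [1 / (1 + 2^-k)], so that letting [k] tend to infinity every mean is at
    distance at least 1 from that limit. *)

From Stdlib Require Import Reals Arith Lra Lia.
From Coquelicot Require Import Coquelicot.
Require Import Defs.
Open Scope R_scope.

(** * Operator norms, contractions and eigenvectors *)

Section OperatorNorm.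
Context {X : CompleteNormedModule C_AbsRing}.
Implicit Types T : bounded_operator X.

(** Boundedness of [T] excludes the supremum [p_infty], which [real] would cast to 0. *)
Lemma norm_le_op_norm T (x : X) : norm x <= 1 -> norm (T x) <= op_norm T.
Proof.
  intros Hx; unfold op_norm.
  generalize (Lub_Rbar_correct
    (fun r => exists x : X, norm x <= 1 /\ r = norm (T x))).
  destruct (linear_norm _ (op_is_linear T)) as [M [HM HT]].
  destruct Lub_Rbar as [l| |]; simpl; intros [H1 H2].
  - apply (H1 (norm (T x))); now exists x.
  - destruct (H2 (Finite M)); intros r [y [Hy ->]].
    apply Rle_trans with (1 := HT y).
    rewrite <- (Rmult_1_r M) at 2; apply Rmult_le_compat_l; lra.
  - destruct (H1 (norm (T x))); now exists x.
Qed.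

(** The zero vector keeps the set of values nonempty, so its supremum is not [m_infty], which [real]
    would also cast to 0; this is why [M] needs no separate sign condition. *)
Lemma op_norm_le T (M : R) :
  (forall x : X, norm x <= 1 -> norm (T x) <= M) -> op_norm T <= M.
Proof.
  intros H; unfold op_norm.
  generalize (Lub_Rbar_correct
    (fun r => exists x : X, norm x <= 1 /\ r = norm (T x))).
  assert (H0 : norm (@zero X) <= 1)
    by (apply Rle_trans with 0; [right; apply (@norm_zero C_AbsRing X) | lra]).
  destruct Lub_Rbar as [l| |]; simpl; intros [H1 H2].
  - apply (H2 (Finite M)); intros r [y [Hy ->]]; now apply H.
  - destruct (H2 (Finite M)); intros r [y [Hy ->]]; now apply H.
  - destruct (H1 (norm (T zero))); now exists zero.
Qed.

Lemma op_pow_norm_le T n (x : X) :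
  (forall y, norm (T y) <= norm y) -> norm (op_pow T n x) <= norm x.
Proof.
  intros HT; induction n as [|n IH]; simpl; [lra |].
  now apply Rle_trans with (1 := HT _).
Qed.

Lemma contraction_power_bounded T :
  (forall y, norm (T y) <= norm y) -> power_bounded T.
Proof.
  intros HT; unfold power_bounded.
  generalize (Sup_seq_correct
    (fun n => Finite (op_norm (op_pow T (Datatypes.S n))))).
  destruct Sup_seq as [l| |]; simpl; try easy.
  (* An infinite supremum would yield a power of norm above 1. *)
  intros H; destruct (H 1) as [n Hn]; revert Hn; apply Rle_not_lt.
  apply op_norm_le; intros x Hx.
  now apply Rle_trans with (1 := op_pow_norm_le T (Datatypes.S n) x HT).
Qed.

Lemma op_pow_eigenvector T (c : C) (x : X) n :
  T x = scal c x -> op_pow T n x = scal (pow_n c n : C_AbsRing) x.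
Proof.
  intros HT; induction n as [|n IH]; simpl.
  - symmetry; apply (scal_one x).
  - change (Nat.iter n T x) with (op_pow T n x); rewrite IH.
    rewrite (linear_scal _ (op_is_linear T)), HT, scal_assoc.
    f_equal; apply Cmult_comm.
Qed.

Lemma op_mean_eigenvector T (l : R) (x : X) n :
  T x = scal (RtoC l) x ->
  op_mean T n x = scal (RtoC (1 / INR n * sum_n_m (fun m => l ^ m) 1 n)) x.
Proof.
  intros HT; simpl.
  assert (E : forall m, pow_n (RtoC l : C_AbsRing) m = RtoC (l ^ m)).
  { induction m as [|m IH]; simpl; [easy |].
    now rewrite IH, RtoC_mult. }
  rewrite RtoC_mult, <- (scal_assoc (RtoC (1 / INR n) : C_AbsRing)).
  f_equal; induction n as [|n IH].
  - rewrite !sum_n_m_zero by lia; symmetry; apply (scal_zero_l x).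
  - rewrite !sum_n_Sm by lia.
    rewrite IH; change (Nat.iter (Datatypes.S n) T x)
      with (op_pow T (Datatypes.S n) x).
    rewrite (op_pow_eigenvector T (RtoC l) x (Datatypes.S n) HT), E.
    etransitivity; [symmetry; apply (@scal_distr_r C_AbsRing X) |].
    f_equal; symmetry; apply RtoC_plus.
Qed.

End OperatorNorm.

(** * Bounded orbits *)

Definition c01_const (c : C) : C01 :=
  MkC01 (fun _ => c) (fun x => continuous_const c x).

(** The orbit of [f] stays in the closed ball of radius [norm f], and the constant [norm f + 1] is
    at distance at least 1 from that ball. *)
Lemma cesaro_not_hypercyclic : ~ hypercyclic cesaro.
Proof.
  intros [f Hf].
  destruct (Hf (c01_const (RtoC (norm f + 1))) (mkposreal 1 Rlt_0_1)) as [n Hn].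
  change (sup_norm (minus (op_pow cesaro n f) (c01_const (RtoC (norm f + 1)))) < 1)
    in Hn.
  assert (H1 := op_pow_norm_le cesaro n f cesaro_norm_le).
  assert (H2 := sup_norm_ub (op_pow cesaro n f) ui0).
  assert (H3 := sup_norm_ub
    (minus (op_pow cesaro n f) (c01_const (RtoC (norm f + 1)))) ui0).
  change (Cmod (op_pow cesaro n f ui0 - RtoC (norm f + 1)) <=
    sup_norm (minus (op_pow cesaro n f) (c01_const (RtoC (norm f + 1))))) in H3.
  change (sup_norm (op_pow cesaro n f)) with (norm (op_pow cesaro n f)) in H2.
  assert (H4 := Cmod_triangle (op_pow cesaro n f ui0)
                  (- (op_pow cesaro n f ui0 - RtoC (norm f + 1)))).
  rewrite Cmod_opp in H4.
  replace (op_pow cesaro n f ui0 + - (op_pow cesaro n f ui0 - RtoC (norm f + 1)))%C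
    with (RtoC (norm f + 1)) in H4 by ring.
  rewrite Cmod_R in H4.
  generalize (Rle_abs (norm f + 1)); intros H5.
  change (norm (op_pow cesaro n f) <= norm f) in H1.
  lra.
Qed.

(** * Strong convergence of the means *)

Lemma cesaro_affine_bound (f : C01) (c : C) (a b : R) :
  (forall t : unit_interval, Cmod (f t - c) <= a + b * t) ->
  forall x : unit_interval, Cmod (cesaro f x - c) <= a + b / 2 * x.
Proof.
  intros H x; simpl; unfold cesaro_fun.
  destruct (Req_EM_T x 0) as [Hx|Hx].
  - rewrite Hx; generalize (H ui0); simpl; lra.
  - assert (Hx0 : 0 < x) by (generalize (ui_bounds x); lra).
    (* The hypothesis is integrated over [[0,x]] before dividing by [x]: [c] becomes [x c], and
       [a + b t] becomes [a x + b x^2 / 2]. *)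
    set (I := RInt _ _ _).
    assert (HI : is_RInt (V := C_R_NormedModule) (fun t => extend f t - c)%C 0 x
                   (I - scal (V := C_R_NormedModule) (x - 0)%R c)%C).
    { apply (is_RInt_minus (V := C_R_NormedModule));
        [apply is_RInt_extend | apply (is_RInt_const (V := C_R_NormedModule))]. }
    assert (HJ : is_RInt (fun t => a + b * t) 0 x (a * x + b * x ^ 2 / 2)).
    { replace (a * x + b * x ^ 2 / 2) with
        (minus ((fun t => a * t + b * t ^ 2 / 2) x)
               ((fun t => a * t + b * t ^ 2 / 2) 0)).
      - apply (is_RInt_derive (fun t => a * t + b * t ^ 2 / 2)).
        + intros t _; auto_derive; [easy | field].
        + intros t _; apply (ex_derive_continuous (fun t => a + b * t)).
          auto_derive; easy.
      - unfold minus, plus, opp; simpl; field. }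
    assert (Hn : Cmod (I - scal (V := C_R_NormedModule) (x - 0)%R c)
                 <= a * x + b * x ^ 2 / 2).
    { rewrite Cmod_norm; apply (norm_RInt_le (V := C_R_NormedModule)
        (fun t => extend f t - c)%C (fun t => a + b * t) 0 x _ _
        (Rlt_le _ _ Hx0)); [| exact HI | exact HJ].
      intros t Ht; rewrite <- Cmod_norm; unfold extend.
      assert (E := H (clamp t)); rewrite clamp_val in E; [exact E |].
      generalize (ui_bounds x); lra. }
    rewrite Rminus_0_r, C_R_scal in Hn.
    assert (E : (RtoC (1 / x) * RtoC x = 1)%C).
    { rewrite <- RtoC_mult; f_equal; field; lra. }
    clearbody I; change C in I.
    replace (RtoC (1 / x) * I - c)%C with (RtoC (1 / x) * (I - RtoC x * c))%C.
    + rewrite Cmod_mult, Cmod_R, Rabs_pos_eq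
        by (apply Rlt_le, Rdiv_lt_0_compat; lra).
      apply Rmult_le_reg_l with x; [easy |].
      replace (x * (1 / x * Cmod (I - RtoC x * c))) with (Cmod (I - RtoC x * c))
        by (field; lra).
      nra.
    + transitivity (RtoC (1 / x) * I - (RtoC (1 / x) * RtoC x) * c)%C;
        [ring | rewrite E; ring].
Qed.

Lemma cesaro_pow_affine_bound (f : C01) (c : C) (a b : R) (n : nat) :
  (forall t : unit_interval, Cmod (f t - c) <= a + b * t) ->
  forall x : unit_interval,
    Cmod (op_pow cesaro n f x - c) <= a + b * (1 / 2) ^ n * x.
Proof.
  intros H; induction n as [|n IH]; intros x.
  - simpl; rewrite Rmult_1_r; apply H.
  - replace (b * (1 / 2) ^ Datatypes.S n) with (b * (1 / 2) ^ n / 2)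
      by (simpl; field).
    apply (cesaro_affine_bound _ c a (b * (1 / 2) ^ n) IH).
Qed.

(** Since [x <= 1], the slopes [b / 2^m] add up to at most a geometric sum. It stays below [b] for
    every [n], so division by [n] will make it vanish. *)
Lemma cesaro_sum_affine_bound (f : C01) (c : C) (a b : R) (n : nat) :
  0 <= b -> (forall t : unit_interval, Cmod (f t - c) <= a + b * t) ->
  forall x : unit_interval,
    Cmod ((sum_n_m (fun m => op_pow cesaro m f) 1 n : C01) x - RtoC (INR n) * c)
      <= INR n * a + b * (1 - (1 / 2) ^ n).
Proof.
  intros Hb H x; induction n as [|n IH].
  - rewrite sum_n_m_zero by lia; simpl.
    replace (RtoC 0 - RtoC 0 * c)%C with (RtoC 0) by ring.
    rewrite Cmod_0; lra.
  - rewrite sum_n_Sm by lia.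
    set (s := sum_n_m _ 1 n) in *.
    change (plus s (op_pow cesaro (Datatypes.S n) f) x)
      with ((s : C01) x + op_pow cesaro (Datatypes.S n) f x)%C.
    rewrite S_INR, RtoC_plus.
    replace ((s : C01) x + op_pow cesaro (Datatypes.S n) f x
             - (RtoC (INR n) + 1) * c)%C
      with (((s : C01) x - RtoC (INR n) * c)
             + (op_pow cesaro (Datatypes.S n) f x - c))%C by ring.
    apply Rle_trans with (1 := Cmod_triangle _ _).
    assert (K := cesaro_pow_affine_bound f c a b (Datatypes.S n) H x).
    assert (K2 : b * (1 / 2) ^ Datatypes.S n * x <= b * (1 / 2) ^ Datatypes.S n).
    { rewrite <- Rmult_1_r; apply Rmult_le_compat_l;
        [| apply ui_bounds].
      apply Rmult_le_pos; [easy | apply pow_le; lra]. }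
    simpl pow in *; lra.
Qed.

(** Away from 0 the slope [b] absorbs the bound [2 |f|]. *)
Lemma c01_affine_bound (f : C01) (a : R) :
  0 < a -> exists b, 0 <= b /\
    forall t : unit_interval, Cmod (f t - f ui0) <= a + b * t.
Proof.
  intros Ha.
  destruct (proj1 (ui_C_continuous f ui0) (c01_continuous f ui0)
              (mkposreal a Ha)) as [d Hd]; simpl in Hd.
  assert (Hd0 := cond_pos d).
  assert (Hf : 0 <= sup_norm f)
    by (apply Rle_trans with (2 := sup_norm_ub f ui0), Cmod_ge_0).
  assert (Hb : 0 <= 2 * sup_norm f / d)
    by (apply Rmult_le_pos; [lra | left; now apply Rinv_0_lt_compat]).
  exists (2 * sup_norm f / d); split; [easy |]; intros t.
  assert (Ht := ui_bounds t).
  destruct (Rlt_le_dec t d) as [H|H].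
  - apply Rle_trans with a.
    + left; apply Hd; rewrite Rminus_0_r, Rabs_pos_eq; lra.
    + generalize (Rmult_le_pos _ _ Hb (proj1 Ht)); lra.
  - apply Rle_trans with (2 * sup_norm f).
    + apply Rle_trans with (1 := Cmod_triangle _ _); rewrite Cmod_opp.
      generalize (sup_norm_ub f t) (sup_norm_ub f ui0); lra.
    + apply Rle_trans with (2 * sup_norm f / d * d).
      * right; field; lra.
      * generalize (Rmult_le_compat_l _ _ _ Hb H); lra.
Qed.

Lemma cesaro_mean_lim (f : C01) :
  filterlim (fun n => op_mean cesaro n f) eventually
    (locally (c01_const (f ui0) : c01_CompleteNormedModule)).
Proof.
  apply filterlim_locally; intros eps.
  assert (He := cond_pos eps).
  (* The mean is within [a + b / n] of [f 0]. With [a = eps / 3] and [n > 3 b / eps], both terms are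
     at most [eps / 3]. *)
  destruct (c01_affine_bound f (eps / 3)) as [b [Hb H]]; [lra |].
  destruct (nfloor_ex (3 * b / eps)) as [N HN].
  { apply Rmult_le_pos; [lra | left; now apply Rinv_0_lt_compat]. }
  exists (Datatypes.S N); intros n Hn.
  assert (HnN : 3 * b / eps < INR n).
  { apply Rlt_le_trans with (1 := proj2 HN).
    rewrite <- S_INR; now apply le_INR. }
  assert (Hn0 : 0 < INR n) by (apply lt_0_INR; lia).
  change (sup_norm (minus (op_mean cesaro n f) (c01_const (f ui0))) < eps).
  apply Rle_lt_trans with (2 * (eps / 3)); [| lra].
  apply sup_norm_le; intros x.
  assert (K := cesaro_sum_affine_bound f (f ui0) (eps / 3) b n Hb H x).
  set (s := sum_n_m _ 1 n) in K.
  change (Cmod (RtoC (1 / INR n) * (s : C01) x - f ui0) <= 2 * (eps / 3)).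
  clearbody s; change C01 in s.
  assert (E : (RtoC (1 / INR n) * RtoC (INR n) = 1)%C).
  { rewrite <- RtoC_mult; f_equal; field; lra. }
  replace (RtoC (1 / INR n) * s x - f ui0)%C
    with (RtoC (1 / INR n) * (s x - RtoC (INR n) * f ui0))%C.
  - rewrite Cmod_mult, Cmod_R, Rabs_pos_eq
      by (apply Rlt_le, Rdiv_lt_0_compat; lra).
    apply Rmult_le_reg_l with (INR n); [easy |].
    rewrite <- Rmult_assoc.
    replace (INR n * (1 / INR n)) with 1 by (field; lra).
    rewrite Rmult_1_l; apply Rle_trans with (1 := K).
    assert (H1 : b <= INR n * (eps / 3)).
    { replace b with (3 * b / eps * (eps / 3)) by (field; lra).
      apply Rmult_le_compat_r; lra. }
    assert (H2 : 0 <= b * (1 / 2) ^ n)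
      by (apply Rmult_le_pos; [easy | apply pow_le; lra]).
    lra.
  - transitivity (RtoC (1 / INR n) * s x
                  - (RtoC (1 / INR n) * RtoC (INR n)) * f ui0)%C;
      [ring | rewrite E; ring].
Qed.

(** This map serves as the strong limit of the means. *)
Lemma eval0_is_linear :
  is_linear (fun f : C01 => c01_const (f ui0)).
Proof.
  split.
  - intros f g; now apply c01_eq.
  - intros c f; now apply c01_eq.
  - exists 1; split; [lra |]; intros f; rewrite Rmult_1_l.
    apply sup_norm_le; intros x; apply (sup_norm_ub f ui0).
Qed.

Lemma cesaro_mean_ergodic : mean_ergodic cesaro.
Proof.
  exists (BoundedOperator (X := c01_CompleteNormedModule) _ eval0_is_linear).
  intros f; apply cesaro_mean_lim.
Qed.

(** * Eigenvectors with eigenvalues close to 1 *)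

(** Iterating [sqrt] gives the right value at 0 and lets each property follow by induction on
    [k]. *)
Definition root (k : nat) (x : R) : R := Nat.iter k sqrt x.

(** Negative [x] are covered because [sqrt] is 0 there. *)
Lemma root_continuous k x : continuous (root k) x.
Proof.
  induction k as [|k IH]; [apply continuous_id |].
  apply (continuous_comp (root k) sqrt); [exact IH | apply continuous_sqrt].
Qed.

Lemma root_0 k : root k 0 = 0.
Proof. induction k as [|k IH]; simpl; [easy | now rewrite IH, sqrt_0]. Qed.

Lemma root_1 k : root k 1 = 1.
Proof. induction k as [|k IH]; simpl; [easy | now rewrite IH, sqrt_1]. Qed.

Lemma root_bounds k x : 0 <= x <= 1 -> 0 <= root k x <= 1.
Proof.
  intros H; induction k as [|k IH]; simpl; [easy |].
  split; [apply sqrt_pos |].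
  rewrite <- sqrt_1; now apply sqrt_le_1_alt.
Qed.

Lemma root_pos k x : 0 < x -> 0 < root k x.
Proof.
  intros H; induction k as [|k IH]; simpl; [easy | now apply sqrt_lt_R0].
Qed.

(** This is [p x^(p-1)] for [p = 2^-k], with [x^(p-1)] written as [root k x / x]. *)
Lemma is_derive_root k x :
  0 < x -> is_derive (root k) x ((1 / 2) ^ k * root k x / x).
Proof.
  intros Hx; induction k as [|k IH].
  - simpl; replace (1 * x / x) with 1 by (field; lra).
    apply (is_derive_id (K := R_AbsRing)).
  - assert (Hr := root_pos k x Hx).
    assert (Hs := sqrt_lt_R0 _ Hr).
    replace ((1 / 2) ^ Datatypes.S k * root (Datatypes.S k) x / x)
      with ((1 / 2) ^ k * root k x / x / (2 * sqrt (root k x))).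
    + apply (is_derive_sqrt (root k) x _ IH Hr).
    + simpl root.
      change (Nat.iter k sqrt x) with (root k x).
      (* The numerator becomes a square, one factor of which cancels. *)
      rewrite <- (sqrt_sqrt (root k x)) at 1 by lra.
      simpl pow; field; split; lra.
Qed.

(** The factor [t] restores differentiability at 0, where [root k] has none for [k >= 1]; this makes
    an antiderivative on the closed interval [[0,x]] available. *)
Lemma is_derive_id_mult_root k x :
  0 <= x ->
  is_derive (fun t => t * root k t) x ((1 + (1 / 2) ^ k) * root k x).
Proof.
  intros [Hx|<-].
  - replace ((1 + (1 / 2) ^ k) * root k x)
      with (1 * root k x + x * ((1 / 2) ^ k * root k x / x)) by (field; lra).
    apply (is_derive_mult (fun t => t) (root k));
      [apply (is_derive_id (K := R_AbsRing)) | now apply is_derive_root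
      | exact Rmult_comm].
  - rewrite root_0, Rmult_0_r.
    (* The difference quotient at 0 is [root k h], which tends to 0 by continuity. *)
    apply is_derive_Reals; intros eps Heps.
    destruct (proj1 (filterlim_locally _ _) (root_continuous k 0)
                (mkposreal eps Heps)) as [d Hd].
    exists d; intros h Hh Hhd.
    assert (K := Hd h).
    rewrite root_0 in K |- *.
    replace ((0 + h) * root k (0 + h) - 0 * 0) with (h * root k h)
      by (rewrite Rplus_0_l; ring).
    replace (h * root k h / h - 0) with (root k h - 0) by (field; easy).
    apply K; change (Rabs (h - 0) < d); now rewrite Rminus_0_r.
Qed.

Lemma is_RInt_root k x :
  0 <= x -> is_RInt (root k) 0 x (x * root k x / (1 + (1 / 2) ^ k)).
Proof.
  intros Hx.
  assert (Hp : 0 < (1 / 2) ^ k) by (apply pow_lt; lra).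
  apply (is_RInt_ext
    (fun t => scal (/ (1 + (1 / 2) ^ k)) ((1 + (1 / 2) ^ k) * root k t))).
  { intros t _; unfold scal; simpl; unfold mult; simpl; field; lra. }
  replace (x * root k x / (1 + (1 / 2) ^ k))
    with (scal (/ (1 + (1 / 2) ^ k)) (minus (x * root k x) (0 * root k 0)))
    by (unfold scal, minus, plus, opp; simpl; unfold mult; simpl; field; lra).
  apply (is_RInt_scal (V := R_NormedModule)).
  apply (is_RInt_derive (fun t => t * root k t)).
  - intros t Ht; apply is_derive_id_mult_root.
    rewrite Rmin_left in Ht; lra.
  - intros t _; apply (continuous_scal_r (V := R_NormedModule)), root_continuous.
Qed.

Lemma ui_root_continuous k (x : unit_interval) :
  continuous (fun t : unit_interval => RtoC (root k t)) x.
Proof.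
  apply ui_C_continuous; intros eps.
  destruct (proj1 (filterlim_locally _ _) (root_continuous k x) eps) as [d Hd].
  exists d; intros y Hy.
  rewrite <- RtoC_minus, Cmod_R; exact (Hd y Hy).
Qed.

Definition c01_root (k : nat) : C01 := MkC01 _ (ui_root_continuous k).

Lemma c01_root_norm k : norm (c01_root k) <= 1.
Proof.
  apply sup_norm_le; intros x; simpl; rewrite Cmod_R.
  destruct (root_bounds k x (ui_bounds x)); now rewrite Rabs_pos_eq.
Qed.

Lemma cesaro_root k :
  cesaro (c01_root k) = scal (RtoC (/ (1 + (1 / 2) ^ k))) (c01_root k).
Proof.
  apply c01_eq; intros x; simpl; unfold cesaro_fun.
  destruct (Req_EM_T x 0) as [Hx|Hx].
  - rewrite Hx; simpl; rewrite root_0; ring.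
  - assert (Hx0 := ui_bounds x).
    assert (Hp : 0 < (1 / 2) ^ k) by (apply pow_lt; lra).
    assert (E : RInt (V := C_R_CompleteNormedModule)
                  (extend (fun t : unit_interval => RtoC (root k t))) 0 x
                = RtoC (x * root k x / (1 + (1 / 2) ^ k))).
    { apply (is_RInt_unique (V := C_R_CompleteNormedModule)).
      apply (is_RInt_ext (V := C_R_NormedModule) (fun t => RtoC (root k t))).
      { rewrite Rmin_left, Rmax_right by lra.
        intros t Ht; unfold extend; rewrite clamp_val; [easy | lra]. }
      (* Real and imaginary parts are integrated separately; the integral of the zero imaginary part
         first appears as [(x - 0) * 0]. *)
      apply (is_RInt_fct_extend_pair (U := R_NormedModule) (V := R_NormedModule)).
      - apply is_RInt_root; lra.
      - assert (K := is_RInt_const (V := R_NormedModule) 0 x 0).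
        exact (eq_ind _ (is_RInt (V := R_NormedModule) (fun _ => 0) 0 x) K 0
                 (Rmult_0_r (x - 0))). }
    rewrite E, <- !RtoC_mult; f_equal; field; split; lra.
Qed.

(** * Failure of norm convergence *)

Lemma Bernoulli_le1 (l : R) (n : nat) :
  0 <= l <= 1 -> 1 - INR n * (1 - l) <= l ^ n.
Proof.
  intros H; induction n as [|n IH]; [simpl; lra |].
  rewrite S_INR; simpl pow.
  assert (K : l * (1 - INR n * (1 - l)) <= l * l ^ n)
    by (apply Rmult_le_compat_l; lra).
  (* Expanding the product leaves the nonnegative remainder [n (1 - l)^2]. *)
  generalize (Rmult_le_pos _ _ (pos_INR n) (pow2_ge_0 (1 - l))); lra.
Qed.

Lemma mean_pow_ge (l : R) (n : nat) :
  0 <= l <= 1 -> (1 <= n)%nat ->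
  1 - INR n * (1 - l) <= 1 / INR n * sum_n_m (fun m => l ^ m) 1 n.
Proof.
  intros Hl Hn.
  assert (Hn0 : 0 < INR n) by (apply lt_0_INR; lia).
  apply Rmult_le_reg_l with (INR n); [easy |].
  rewrite <- (Rmult_assoc (INR n) (1 / INR n)).
  replace (INR n * (1 / INR n)) with 1 by (field; lra).
  rewrite Rmult_1_l.
  (* Every power up to the [n]-th exceeds or equals the same bound, so [n] is kept fixed while the
     number [p] of summands grows. *)
  assert (H : forall p, (p <= n)%nat ->
    INR p * (1 - INR n * (1 - l)) <= sum_n_m (fun m => l ^ m) 1 p).
  { induction p as [|p IH]; intros Hp.
    - rewrite sum_n_m_zero by lia; change (0 * (1 - INR n * (1 - l)) <= 0); lra.
    - rewrite sum_n_Sm by lia; rewrite S_INR.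
      change (plus (sum_n_m (fun m => l ^ m) 1 p) (l ^ Datatypes.S p))
        with (sum_n_m (fun m => l ^ m) 1 p + l ^ Datatypes.S p).
      assert (K := Bernoulli_le1 l (Datatypes.S p) Hl).
      assert (K2 : INR (Datatypes.S p) * (1 - l) <= INR n * (1 - l))
        by (apply Rmult_le_compat_r; [lra | now apply le_INR]).
      generalize (IH ltac:(lia)); lra. }
  now apply H.
Qed.

Lemma cesaro_not_uniformly_mean_ergodic : ~ uniformly_mean_ergodic cesaro.
Proof.
  intros [P HP].
  (* Norm convergence implies convergence at each vector of the unit ball, so uniqueness of limits
     identifies [P] there; the eigenvectors lie in that ball. *)
  assert (HPf : forall f : C01, norm f <= 1 -> P f = c01_const (f ui0)).
  { intros f Hf.
    apply (filterlim_locally_unique (K := C_AbsRing)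
             (V := c01_CompleteNormedModule)
             (F := eventually) (fun n => op_mean cesaro n f));
      [| apply cesaro_mean_lim].
    apply filterlim_locally; intros eps.
    generalize (proj1 (filterlim_locally _ _) HP eps); apply filter_imp.
    intros n Hn.
    change (norm (op_minus (op_mean cesaro n) P f) < eps).
    apply Rle_lt_trans with (1 := norm_le_op_norm _ f Hf).
    apply Rle_lt_trans with (1 := Rle_abs _).
    rewrite <- (Rminus_0_r (op_norm _)); exact Hn. }
  (* One mean closer than 1/2 to [P] already gives a contradiction, so no limit in [k] is taken. *)
  assert (Hh : 0 < 1 / 2) by lra.
  destruct (proj1 (filterlim_locally _ _) HP (mkposreal _ Hh)) as [N HN].
  (* The successor ensures [n >= 1]. *)
  set (n := Datatypes.S N).
  assert (Hn : op_norm (op_minus (op_mean cesaro n) P) < 1 / 2).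
  { assert (K := HN n (Nat.le_succ_diag_r N)).
    apply Rle_lt_trans with (1 := Rle_abs _).
    rewrite <- (Rminus_0_r (op_norm _)); exact K. }
  assert (Hn0 : 0 < INR n) by (apply lt_0_INR; unfold n; lia).
  assert (Hn1 : 0 < / (2 * INR n)) by (apply Rinv_0_lt_compat; lra).
  (* With [2^-k < 1 / (2 n)], the eigenvalue [l] satisfies [n (1 - l) <= 1/2], because
     [1 - l = 2^-k l]. *)
  destruct (pow_lt_1_zero (1 / 2) ltac:(rewrite Rabs_pos_eq; lra) _ Hn1)
    as [k Hk].
  specialize (Hk k (le_n k)).
  assert (Hp : 0 < (1 / 2) ^ k) by (apply pow_lt; lra).
  rewrite Rabs_pos_eq in Hk by lra.
  set (l := / (1 + (1 / 2) ^ k)).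
  assert (Hl : 0 <= l).
  { left; apply Rinv_0_lt_compat; lra. }
  assert (E : (1 + (1 / 2) ^ k) * l = 1) by (unfold l; field; lra).
  assert (Hl2 : l <= 1) by nra.
  assert (Hl1 : 1 - l <= (1 / 2) ^ k) by nra.
  assert (Hm := mean_pow_ge l n (conj Hl Hl2) ltac:(unfold n; lia)).
  assert (Hs : INR n * (1 - l) <= 1 / 2).
  { apply Rle_trans with (INR n * / (2 * INR n));
      [apply Rmult_le_compat_l; lra | right; field; lra]. }
  revert Hn; apply Rle_not_lt.
  apply Rle_trans with
    (2 := norm_le_op_norm (op_minus (op_mean cesaro n) P) _ (c01_root_norm k)).
  change (op_minus (op_mean cesaro n) P (c01_root k))
    with (minus (op_mean cesaro n (c01_root k)) (P (c01_root k))).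
  rewrite (HPf _ (c01_root_norm k)).
  rewrite (op_mean_eigenvector cesaro l (c01_root k) n (cesaro_root k)).
  set (s := 1 / INR n * _) in *.
  (* At the point 1 the eigenvector equals 1, so the difference there is the average [s] itself. *)
  apply Rle_trans with (2 := sup_norm_ub _ (clamp 1)).
  change (1 / 2 <= Cmod (RtoC s * RtoC (root k (clamp 1)) - RtoC (root k 0))).
  rewrite clamp_val, root_0, root_1 by lra.
  replace (RtoC s * RtoC 1 - RtoC 0)%C with (RtoC s) by ring.
  rewrite Cmod_R; generalize (Rle_abs s); lra.
Qed.

Theorem theorem2p3 :
  power_bounded cesaro /\ mean_ergodic cesaro /\
  ~ uniformly_mean_ergodic cesaro /\ ~ hypercyclic cesaro.
Proof.
  split; [apply contraction_power_bounded, cesaro_norm_le |].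
  split; [apply cesaro_mean_ergodic |].
  split; [apply cesaro_not_uniformly_mean_ergodic |].
  apply cesaro_not_hypercyclic.
Qed.
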